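(* Let $d$ be a positive integer and $\Delta$ an integer with $\Delta\geq 6.21d$. Every $d$-degenerate graph $G$ with $\Delta(G)\leq \Delta$ has an equitable $\Delta$-coloring.
   Context: All graphs are finite and simple. A graph is $d$-degenerate if every subgraph of it has a vertex of degree at most $d$. $\Delta(G)$ denotes the maximum degree of $G$. An equitable $r$-coloring of a graph is a partition of its vertex set into $r$ independent sets $V_1,\dots,V_r$ (some possibly empty) with $\big||V_i|-|V_j|\big|\leq 1$ for all $i,j$. *)

(* Defs.v *)
From mathcomp Require Import all_boot.
Set Implicit Arguments. Unset Strict Implicit. Unset Printing Implicit Defensive.

Definition simple_graph (T : finType) (e : rel T) : Prop :=
  irreflexive e /\ symmetric e.

Definition deg (T : finType) (e : rel T) (v : T) : nat := #|[set u | e v u]|.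

Definition max_deg_le (T : finType) (e : rel T) (D : nat) : Prop :=
  forall v, deg e v <= D.

(* A subgraph (S, e') of G = (T, e): vertex set S, edge relation e' contained in e,
   considered on S. G is d-degenerate if every (nonempty) subgraph has a vertex
   of degree at most d (degree computed inside the subgraph). *)
Definition degenerate (T : finType) (e : rel T) (d : nat) : Prop :=
  forall (S : {set T}) (e' : rel T),
    symmetric e' -> (forall x y, e' x y -> e x y) ->
    S != set0 ->
    exists2 v, v \in S & #|[set u in S | e' v u]| <= d.

Definition equitable_coloring (T : finType) (e : rel T) (r : nat)
  (f : T -> 'I_r) : Prop :=
  (forall x y, e x y -> f x != f y) /\
  (forall i j : 'I_r, #|[set x | f x == i]| <= #|[set x | f x == j]|.+1).

(* Main.v *)
Require Import Defs.
From mathcomp Require Import all_boot zify.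

Set Implicit Arguments.
Unset Strict Implicit.
Unset Printing Implicit Defensive.

(** Write [r] for [Delta].  Padding [G] with a disjoint clique on at most [d + 1]
vertices, or deleting a vertex of degree at most [d], reduces to [#|V| = r s];
then delete the edges at a vertex of degree at most [d] and induct.  It remains
to repair nearly equitable colorings: one class [a] of size [s - 1], one class
[b] of size [s + 1], all others of size [s].  Take one whose class [a] has
minimal degree sum, and let [c] be the number of classes reachable from [b],
where [i] leads to [j] if some vertex of [i] has no neighbor in [j].  If [a] is
reachable, shifting vertices along a path gives an equitable coloring.
Otherwise each vertex of a reachable class has a neighbor in every unreachable
class, so that [c (r - c) < d r].

Upper bound [2 c <= r + 2 d + 1]: let [y] lie in a reachable class and have
exactly one neighbor [w] in [a].  If [w] can move to some other class, or [y] is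
its only neighbor in the class of [y], then [w] and [y] can be exchanged, whence
[deg w <= deg y] by minimality; only two such [y] per [w] escape this.  As there
are many such [y], double counting makes the degree sum too large unless [c] is
small.

Lower bound [r <= 2 c + 1 + d]: remove one vertex [z] from the large class and
let it float.  If [z] has a single neighbor [y] in a class other than [a], then
[z] can take the place of [y], which floats instead.  By degeneracy some
vertex [z] that can float has at most [d] neighbors that can float, so [z] has
no neighbor in at least [(r - 1 - d) / 2] classes; dropping [z] in one of them
makes all of these reachable.

The three bounds are incompatible with [r >= 6.21 d]. *)


(** * Degenerate graphs *)

Lemma degenerate_induced (T : finType) (e : rel T) (d : nat) :
  symmetric e ->
  degenerate e d <->
  (forall S : {set T}, S != set0 ->
     exists2 v, v \in S & #|[set u in S | e v u]| <= d).
Proof.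
move=> syme; split=> [degE S | degE S e' _ sub_e' /degE[v vS dv]]; first exact: degE.
exists v => //; apply: leq_trans dv; apply: subset_leq_card; apply/subsetP=> u.
by rewrite !inE => /andP[-> /sub_e'].
Qed.

(** Covers both the deletion of edges, with [h] the identity, and the deletion of a vertex, with
    [h = val]. *)
Lemma degenerate_inj (T T' : finType) (e : rel T) (e' : rel T') (h : T' -> T) d :
  symmetric e -> symmetric e' -> injective h ->
  (forall x y, e' x y -> e (h x) (h y)) -> degenerate e d -> degenerate e' d.
Proof.
move=> syme syme' injh he /(degenerate_induced _ syme) degE.
apply/(degenerate_induced _ syme') => S /set0Pn[x0 x0S].
have [|_ /imsetP[v vS ->] dv] := degE (h @: S).
  by apply/set0Pn; exists (h x0); rewrite imset_f.
exists v => //; apply: leq_trans dv; rewrite -(card_imset _ injh).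
apply: subset_leq_card; apply/subsetP=> _ /imsetP[u + ->].
by rewrite !inE => /andP[uS /he ->]; rewrite imset_f.
Qed.

(** Removing a vertex of degree at most [d] destroys at most [d] edges, and each edge counts twice
    in the degree sum. *)
Lemma degenerate_sum_deg (T : finType) (e : rel T) (d : nat) :
  symmetric e -> irreflexive e -> degenerate e d ->
  \sum_v deg e v <= 2 * d * #|T|.
Proof.
move=> syme irre /(degenerate_induced _ syme) degE.
suff main (S : {set T}) : \sum_(v in S) #|[set u in S | e v u]| <= 2 * d * #|S|.
  have := main [set: T]; rewrite cardsT; apply: leq_trans.
  have -> : \sum_v deg e v = \sum_(v in [set: T]) deg e v.
    by apply: eq_bigl => v; rewrite inE.
  apply: leq_sum => v _; apply: subset_leq_card.
  by apply/subsetP=> u; rewrite !inE.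
have [n] := ubnP #|S|; elim: n S => // n IH S; rewrite ltnS => leSn.
have [->|S0] := eqVneq S set0; first by rewrite big_set0.
have [v vS dv] := degE S S0.
have cS : #|S| = #|S :\ v|.+1 by rewrite (cardsD1 v S) vS.
rewrite (bigD1 v) //= (eq_bigl (mem (S :\ v))); last by move=> u; rewrite !inE andbC.
have step u : u \in S :\ v ->
    #|[set t in S | e u t]| = #|[set t in S :\ v | e u t]| + e v u.
  move=> uS; rewrite (cardsD1 v) !inE vS syme addnC; congr (_ + _).
  by apply: eq_card => t; rewrite !inE; case: (t == v).
rewrite (eq_bigr _ step) big_split /=.
have -> : \sum_(u in S :\ v) e v u = #|[set u in S | e v u]|.
  rewrite -sum1_card big_mkcond [RHS]big_mkcond; apply: eq_bigr => u _.
  by rewrite !inE; case: eqVneq => [->|] //=; rewrite ?irre ?andbF //; case: (u \in S); case: (e v u).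
by have := IH (S :\ v); rewrite cS in leSn *; move=> /(_ leSn); lia.
Qed.


(** * Recoloring, and shifting along a path of classes *)

Section Colorings.

Variables (T : finType) (e : rel T) (r : nat).
Hypotheses (irre : irreflexive e) (syme : symmetric e).
Implicit Types (f : {ffun T -> 'I_r}) (c i j : 'I_r).

Definition cls f c := [set x | f x == c].

Definition cnbr f v c := [set u | e v u && (f u == c)].

Definition proper_coloring f := [forall x, forall y, e x y ==> (f x != f y)].

Definition recolor f v c : {ffun T -> 'I_r} :=
  [ffun x => if x == v then c else f x].

Definition movable f i j := [exists v, (f v == i) && (cnbr f v j == set0)].

Lemma proper_coloringP f : reflect (forall x y, e x y -> f x != f y) (proper_coloring f).
Proof.
apply: (iffP forallP) => [pf x y exy | pf x].
  by have /forallP/(_ y)/implyP := pf x; apply.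
by apply/forallP=> y; apply/implyP/pf.
Qed.

Lemma card_cls_recolor f v c k :
  #|cls (recolor f v c) k| + (k == f v) = #|cls f k| + (k == c).
Proof.
rewrite (cardsD1 v (cls f k)) (cardsD1 v (cls _ k)) !inE ffunE eqxx.
have -> : cls (recolor f v c) k :\ v = cls f k :\ v.
  by apply/setP=> x; rewrite !inE ffunE; case: eqP.
by rewrite (eq_sym k) (eq_sym k); lia.
Qed.

Lemma cnbr0P f v c : reflect (forall u, e v u -> f u != c) (cnbr f v c == set0).
Proof.
apply: (iffP eqP) => [E u evu | H].
  by apply: contra_eqN E => fu; apply/set0Pn; exists u; rewrite inE evu.
by apply/setP=> u; rewrite !inE; apply/negP=> /andP[/H/negP].
Qed.

Lemma proper_recolor_off f v c :
  (forall x y, x != v -> y != v -> e x y -> f x != f y) ->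
  (forall u, e v u -> f u != c) -> proper_coloring (recolor f v c).
Proof.
move=> pf nv; apply/proper_coloringP=> x y; rewrite !ffunE.
have [->|xv] := eqVneq x v; have [->|yv] := eqVneq y v; rewrite ?irre //.
- by move/nv; rewrite eq_sym.
- by rewrite syme => /nv.
- exact: pf.
Qed.

Lemma proper_recolor f v c :
  proper_coloring f -> (forall u, e v u -> f u != c) -> proper_coloring (recolor f v c).
Proof. by move=> /proper_coloringP pf; apply: proper_recolor_off => x y _ _ /pf. Qed.

Lemma sum_cnbr f v : \sum_c #|cnbr f v c| = deg e v.
Proof.
rewrite /deg -sum1_card (partition_big f predT) //=; apply: eq_bigr => c _.
by rewrite -sum1_card; apply: eq_bigl => u; rewrite !inE.
Qed.

(** The tail of the path is shifted first, so that [c] has gained nothing when the vertex of [b]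
    enters it. The last two clauses say that only classes before the last lose vertices and only
    classes in [p] gain some. *)
Lemma shift_path f b p :
  proper_coloring f -> path (movable f) b p -> uniq (b :: p) ->
  exists f' : {ffun T -> 'I_r},
    [/\ proper_coloring f',
        forall c, #|cls f' c| + (c == b) = #|cls f c| + (c == last b p),
        forall v, f v \notin belast b p -> f' v = f v
      & forall v, f' v \notin p -> f' v = f v].
Proof.
move=> pf; elim: p b => [|c p IH] b /=; first by exists f.
case/andP=> /existsP[u /andP[/eqP fu /cnbr0P nu]] pth /and3P[bcp cp up].
have [|f' [pf' sz keep back]] := IH c pth; first by rewrite /= cp.
have b_bel : b \notin belast c p.
  by apply: contra bcp => /mem_belast.
have f'u : f' u = b by rewrite keep fu.
exists (recolor f' u c); split.
- apply: proper_recolor => // w /nu; apply: contraNneq => f'w.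
  by rewrite -back f'w.
- move=> k; have := card_cls_recolor f' u c k; have := sz k.
  by rewrite f'u; lia.
- move=> v; rewrite inE negb_or ffunE => /andP[fvb fv].
  by case: eqP => [vu|_]; [rewrite vu fu eqxx in fvb | exact: keep].
- move=> v; rewrite ffunE; case: eqP => [_|_]; first by rewrite mem_head.
  by rewrite inE negb_or => /andP[_ /back].
Qed.

End Colorings.


(** * Nearly equitable colorings and exchanges *)

Lemma degE (T : finType) (e : rel T) v : deg e v = \sum_u e v u.
Proof.
rewrite /deg -sum1_card big_mkcond; apply: eq_bigr => u _.
by rewrite inE; case: (e v u).
Qed.

Section NearEquitable.

Variables (T : finType) (e : rel T) (r s : nat).
Hypotheses (irre : irreflexive e) (syme : symmetric e).
Implicit Types (f : {ffun T -> 'I_r}) (a b c : 'I_r).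

(* [near f a a] says that [f] is proper with all classes of size [s]. *)
Definition near f a b :=
  proper_coloring e f && [forall c, #|cls f c| + (c == a) == s + (c == b)].

Definition weight f a := \sum_(v in cls f a) deg e v.

Lemma nearP f a b :
  reflect (proper_coloring e f /\ forall c, #|cls f c| + (c == a) = s + (c == b))
          (near f a b).
Proof.
apply: (iffP andP) => [] [pf H]; split=> //.
  by move=> c; apply/eqP; have/forallP := H.
by apply/forallP=> c; apply/eqP.
Qed.

Lemma card_cls_exchange f a w y X c :
  f w = a -> w != y ->
  #|cls (recolor (recolor f y a) w X) c| + (c == f y) = #|cls f c| + (c == X).
Proof.
move=> fw wy; have := card_cls_recolor (recolor f y a) w X c.
have := card_cls_recolor f y a c.
by rewrite [recolor f y a w]ffunE (negPf wy) fw; lia.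
Qed.

(** The only possible obstacle to [y] entering [a] is [w], the only one to [w] entering [X] is [y],
    and both leave. *)
Lemma proper_exchange f a w y X :
  proper_coloring e f -> f w = a -> X != a ->
  (forall u, e y u -> f u = a -> u = w) ->
  (forall u, e w u -> f u = X -> u = y) ->
  proper_coloring e (recolor (recolor f y a) w X).
Proof.
move=> /proper_coloringP pf fw Xa uniq_w uniq_y; apply: proper_recolor_off => //.
  move=> x z xw zw exz; rewrite !ffunE.
  have [xy|xy] := eqVneq x y; have [zy|zy] := eqVneq z y; last exact: pf.
  - by move: exz; rewrite xy zy irre.
  - apply: contraNneq zw => /esym fz; apply/eqP; apply: uniq_w => //.
    by rewrite -xy.
  - apply: contraNneq xw => fx; apply/eqP; apply: uniq_w => //.
    by rewrite -zy syme.
move=> u ewu; rewrite ffunE; have [_|uy] := eqVneq u y; first by rewrite eq_sym.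
by apply: contraNneq uy => fu; apply/eqP; apply: uniq_y.
Qed.

Lemma weight_exchange f a w y X :
  f w = a -> f y != a -> X != a ->
  weight (recolor (recolor f y a) w X) a + deg e w = weight f a + deg e y.
Proof.
move=> fw fy Xa; have wy : w != y by apply: contraNneq fy => <-; rewrite fw.
rewrite /weight (bigD1 y) /=; last by rewrite inE !ffunE (eq_sym y w) (negPf wy) !eqxx.
rewrite [in RHS](bigD1 w) /=; last by rewrite inE fw.
rewrite (eq_bigl (fun v => (v \in cls f a) && (v != w))); first lia.
move=> v; rewrite !inE !ffunE; have [->|vw] := eqVneq v w.
  by rewrite (negPf Xa) andbF.
by have [->|vy] := eqVneq v y; rewrite ?andbF ?andbT ?(negPf fy).
Qed.

(** After a shift along a path from [b] the surplus vertex lies in the class of [y]; then [y] moves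
    to [a] and [w] to [X]. In the second alternative [w] and [y] trade classes. No shift touches
    [a], so only the exchange changes its degree sum. *)
Lemma near_exchange f a b w y :
  near f a b -> a != b -> connect (movable e f) b (f y) ->
  ~~ connect (movable e f) b a -> f w = a -> e w y ->
  (forall u, e y u -> f u = a -> u = w) ->
  (exists2 X, X != a & cnbr e f w X = set0)
    \/ (forall u, e w u -> f u = f y -> u = y) ->
  exists f' b', near f' a b' /\ weight f' a + deg e w = weight f a + deg e y.
Proof.
move=> /nearP[pf sz] ab b_y b_a fw ewy uniq_w.
have fya : f y != a by apply: contraNneq b_a => <-.
have wy : w != y by apply: contraTneq ewy => ->; rewrite irre.
case=> [[X Xa /eqP/cnbr0P wX] | uniq_y]; last first.
  exists (recolor (recolor f y a) w (f y)), b; split; last exact: weight_exchange.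
  apply/nearP; split=> [|c]; first exact: proper_exchange.
  by have := card_cls_exchange (f y) c fw wy; have := sz c; lia.
(* Shift a vertex out of the class [b0], which is [X] if the path from [b] to
   the class of [y] meets [X], and [b] otherwise. *)
have [b0 [p [[pth up lastp] [Xp ap b0bX]]]] : exists b0 p,
    [/\ path (movable e f) b0 p, uniq (b0 :: p) & last b0 p = f y] /\
    [/\ X \notin p, a \notin b0 :: p & (b0 == b) || (b0 == X)].
  have [q0 q0p q0l] := connectP b_y.
  move: q0l; case: (shortenP q0p) => q qp uq _ ql.
  have aq : a \notin b :: q.
    by apply: contra b_a => /(path_connect qp).
  have [Xq|Xq] := boolP (X \in b :: q); last first.
    exists b, q; split; split; rewrite ?eqxx //.
    by apply: contra Xq => Xq; rewrite inE Xq orbT.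
  case/splitPl def_q: q / Xq qp uq ql aq => [q1 q2 lX].
  rewrite cat_path lX last_cat => /andP[_ q2p] uq ql aq.
  have uX : uniq (X :: q2).
    move: uq; rewrite -cat_cons lastI lX cat_rcons cat_uniq.
    by case/and3P.
  exists X, q2; split; split; rewrite ?eqxx ?orbT //.
  - by rewrite ql lX.
  - by case/andP: uX.
  - apply: contra aq; rewrite !inE mem_cat => /orP[/eqP->|->]; last by rewrite !orbT.
    by rewrite -lX; have := mem_last b q1; rewrite inE; case/orP=> ->; rewrite ?orbT.
have [g [pg szg keep back]] := shift_path irre syme pf pth up.
have gy : g y = f y.
  apply: keep; rewrite -lastp; move: up; rewrite lastI rcons_uniq.
  by case/andP.
have ga v : f v = a -> g v = a.
  move=> fv; rewrite keep fv //; apply: contra ap; exact: mem_belast.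
have ag v : g v = a -> f v = a.
  move=> gv; rewrite -back ?gv //; apply: contra ap; rewrite inE => ->.
  by rewrite orbT.
have gw : g w = a by exact: ga.
(* From [b0 = b] the surplus ends in [X]; from [b0 = X] the vertex [w] replaces the one that [X]
   lost, and the surplus stays in [b]. *)
exists (recolor (recolor g y a) w X), (if b0 == b then X else b); split.
  apply/nearP; split=> [|c].
    apply: proper_exchange => // u.
      by move=> eyu /ag; apply: uniq_w.
    move=> ewu gu; have fu : f u = X by rewrite -back ?gu.
    by have := wX u ewu; rewrite fu eqxx.
  have := card_cls_exchange X c gw wy; have := sz c; have := szg c.
  rewrite lastp gy; case: eqVneq b0bX => [->|_ /= /eqP->]; clear; lia.
have -> : weight f a = weight g a.
  apply: eq_bigl => v; rewrite !inE; apply/eqP/eqP; [exact: ga | exact: ag].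
by apply: weight_exchange; rewrite // gy.
Qed.

End NearEquitable.


(** * Counting edges at the reachable classes *)

Section MinimalNearEquitable.

Variables (T : finType) (e : rel T) (r s : nat).
Hypotheses (irre : irreflexive e) (syme : symmetric e).
Hypothesis maxd : max_deg_le e r.
Hypothesis no_equitable :
  forall (f : {ffun T -> 'I_r}) a, ~~ near e s f a a.

Variables (f : {ffun T -> 'I_r}) (a b : 'I_r).
Hypothesis near_f : near e s f a b.
Hypothesis min_f :
  forall (f' : {ffun T -> 'I_r}) a' b', near e s f' a' b' -> weight e f a <= weight e f' a'.

Definition reached := [set c | connect (movable e f) b c].

Definition hull := [set y | f y \in reached].

Lemma reached_bottom : a \notin reached.
Proof.
rewrite inE; apply/negP=> /connectP[q0 q0p q0l].
move: q0l; case: (shortenP q0p) => q qp uq _ ql.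
have /nearP[pf sz] := near_f.
have [f' [pf' sz' _ _]] := shift_path irre syme pf qp uq.
have /negP[] := no_equitable f' a; apply/nearP; split=> // c.
by have := sz c; have := sz' c; rewrite -ql; clear; lia.
Qed.

Lemma near_neq : a != b.
Proof. by apply: contraTneq near_f => <-; exact: no_equitable. Qed.

Lemma card_hull : #|hull| = #|reached| * s + 1.
Proof.
have /nearP[_ sz] := near_f.
rewrite -sum1_card (partition_big f (mem reached)) /=; last by move=> y; rewrite inE.
have -> : #|reached| * s + 1 = \sum_(c in reached) (s + (c == b)).
  rewrite big_split /= sum_nat_const [in RHS](bigD1 b) /= ?inE ?connect0 // eqxx.
  by rewrite big1 // => c /andP[_ /negPf->].
apply: eq_bigr => c cR; have ca : c != a by apply: contraNneq reached_bottom => <-.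
have := sz c; rewrite (negPf ca) addn0 => <-.
rewrite -sum1_card; apply: eq_bigl => y; rewrite !inE.
by case: eqVneq => [->|]; rewrite ?andbF // andbT; move: cR; rewrite inE.
Qed.

Lemma cnbr_hull y c : y \in hull -> c \notin reached -> 0 < #|cnbr e f y c|.
Proof.
rewrite card_gt0 !inE => fy; apply: contra => yc.
apply: connect_trans fy _; apply: connect1; apply/existsP; exists y.
by rewrite eqxx.
Qed.

Lemma card_cnbr v c : #|cnbr e f v c| = \sum_(u in cls f c) e v u.
Proof.
rewrite -sum1_card big_mkcond [RHS]big_mkcond; apply: eq_bigr => u _.
by rewrite !inE; case: (e v u); case: (f u == c).
Qed.

(** Every hull vertex has a neighbor in each unreached class, and the degree sum counts each
    crossing edge at both ends. *)
Lemma hull_boundary : 2 * (#|hull| * (r - #|reached|)) <= \sum_v deg e v.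
Proof.
have out y : y \in hull -> r - #|reached| <= \sum_(x in ~: hull) e y x.
  move=> yK; rewrite (partition_big f (mem (~: reached))) /=; last first.
    by move=> x; rewrite !inE.
  have -> : r - #|reached| = \sum_(c in ~: reached) 1.
    by rewrite sum1_card [RHS]cardsCs setCK card_ord.
  apply: leq_sum => c.
  rewrite inE => cR; apply: leq_trans (cnbr_hull yK cR) _.
  rewrite card_cnbr [leqRHS](eq_bigl (mem (cls f c))) // => x; rewrite !inE.
  by case: eqP => [->|]; rewrite ?andbF // andbT; move: cR; rewrite inE.
have half1 : #|hull| * (r - #|reached|) <= \sum_(y in hull) \sum_(x in ~: hull) e y x.
  by rewrite -sum_nat_const leq_sum.
have le1 : \sum_(y in hull) \sum_(x in ~: hull) e y x <= \sum_(y in hull) deg e y.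
  apply: leq_sum => y _; rewrite degE [leqRHS](bigID (mem (~: hull))) /=.
  exact: leq_addr.
have le2 : \sum_(y in hull) \sum_(x in ~: hull) e y x <= \sum_(x in ~: hull) deg e x.
  rewrite exchange_big; apply: leq_sum => x _ /=.
  rewrite degE [leqRHS](bigID (mem hull)) /=.
  rewrite (eq_bigr (fun y => nat_of_bool (e x y))) ?leq_addr // => y _.
  by rewrite syme.
rewrite (bigID (mem hull)) /=.
have -> : \sum_(i | i \notin hull) deg e i = \sum_(i in ~: hull) deg e i.
  by apply: eq_bigl => i; rewrite in_setC.
rewrite mul2n -addnn; apply: leq_add.
  exact: leq_trans half1 le1.
exact: leq_trans half1 le2.
Qed.

Definition solo y := #|cnbr e f y a| == 1.

(** The solo neighbors of [w] whose exchange with [w] would lower the weight; by minimality that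
    exchange must be impossible. *)
Definition light w :=
  [set y in hull | [&& solo y, e w y & deg e y < deg e w]].

Lemma soloP w y : f w = a -> e w y -> solo y -> forall u, e y u -> f u = a -> u = w.
Proof.
move=> fw ewy /cards1P[w' E] u eyu fu.
have: u \in cnbr e f y a by rewrite inE eyu fu eqxx.
have: w \in cnbr e f y a by rewrite inE syme ewy fw eqxx.
by rewrite E !inE => /eqP-> /eqP.
Qed.

Lemma light_blocked w y : f w = a -> y \in light w ->
  (forall X, X != a -> cnbr e f w X != set0) /\ 2 <= #|cnbr e f w (f y)|.
Proof.
move=> fw; rewrite inE => /and4P[]; rewrite !inE => yK sy ewy dyw.
have no_exch : ~ ((exists2 X, X != a & cnbr e f w X = set0)
    \/ (forall u, e w u -> f u = f y -> u = y)).
  move=> H.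
  have [|f' [b' [/min_f + E]]] := near_exchange irre syme near_f near_neq yK _
    fw ewy (soloP fw ewy sy) H.
    by have := reached_bottom; rewrite inE.
  by move: E dyw; clear; lia.
split=> [X Xa|].
  by apply/negP=> /eqP E; apply: no_exch; left; exists X.
rewrite ltnNge; apply/negP=> le1; apply: no_exch; right=> u ewu fu.
have/card_le1P/(_ y) := le1; rewrite !inE ewy eqxx => /(_ isT u).
by rewrite !inE ewu fu eqxx => /esym/eqP.
Qed.

(** If a light vertex exists, [w] has neighbors in all [r - 1] classes other than [a]. As
    [deg w <= r], at most one of these classes holds two neighbors, and none holds three; light
    vertices lie only in such a class. *)
Lemma card_light w : f w = a -> #|light w| <= 2.
Proof.
move=> fw; have [->|/set0Pn[y0 y0L]] := eqVneq (light w) set0.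
  by rewrite cards0.
have [blocked _] := light_blocked fw y0L.
have n_gt0 c : c != a -> 0 < #|cnbr e f w c| by move=> /blocked; rewrite -card_gt0.
have sum1 : \sum_(c | c != a) (#|cnbr e f w c| - 1) <= 1.
  have := maxd w; rewrite -(sum_cnbr e f w) (bigD1 a) //=.
  have -> : \sum_(c | c != a) #|cnbr e f w c| =
      \sum_(c | c != a) (#|cnbr e f w c| - 1) + \sum_(c | c != a) 1.
    by rewrite -big_split; apply: eq_bigr => c /n_gt0 /=; clear; lia.
  rewrite sum1_card cardC1 card_ord; have := ltn_ord a.
  have aux x D : a < r -> x + (D + r.-1) <= r -> D <= 1 by clear; lia.
  exact: aux.
suff: #|light w| <= \sum_(c | c != a) 2 * (#|cnbr e f w c| - 1).
  rewrite -big_distrr /= => /leq_trans; apply; exact: (leq_mul (leqnn 2) sum1).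
rewrite -sum1_card (partition_big f (fun c => c != a)) /=; last first.
  move=> y; rewrite inE => /andP[yK _]; apply: contraNneq reached_bottom => <-.
  by move: yK; rewrite inE.
apply: leq_sum => c ca; rewrite sum1dep_card.
have [E|[y]] := set_0Vmem [set y in light w | f y == c].
  by rewrite E cards0.
rewrite inE => /andP[yL /eqP fy]; have [_] := light_blocked fw yL; rewrite fy => n2.
apply: (@leq_trans #|cnbr e f w c|); last by move: n2; clear; lia.
apply: subset_leq_card; apply/subsetP=> u; rewrite !inE.
by case/andP=> /and4P[_ _ -> _] ->.
Qed.

(** [E w] counts the hull neighbors of [w], [S w] the solo ones. A solo neighbor [y] that is not
    light has [deg y >= deg w >= E w], so [S w * E w] is at most the degree sum of the solo
    neighbors, up to [2 r] for two light ones. Over all [w] in class [a] each solo vertex occurs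
    once. *)
Lemma hull_domination :
  2 * r * #|hull| <= \sum_v deg e v + (r * r + 2 * r) * #|cls f a|.
Proof.
pose E w := \sum_(y in hull) e w y.
pose S w := \sum_(y in hull | solo y) e w y.
have E_deg w : E w <= deg e w by rewrite degE [leqRHS](bigID (mem hull)) leq_addr.
have SE w : S w <= E w by rewrite /E (bigID solo) /= leq_addr.
have cnbr_a y : \sum_(w in cls f a) e w y = #|cnbr e f y a|.
  by rewrite card_cnbr; apply: eq_bigr => w _; rewrite syme.
(* A hull vertex with a single neighbor in [a] is solo and counts in both sums; any other has at
   least two neighbors there. *)
have cE : 2 * #|hull| <= \sum_(w in cls f a) (E w + S w).
  rewrite big_split /= exchange_big /= [X in _ + X]exchange_big /=.
  rewrite [X in _ + X]big_mkcondr -big_split /= mulnC -sum_nat_const.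
  apply: leq_sum => y yK; have := cnbr_hull yK reached_bottom.
  by rewrite cnbr_a /solo; case: eqP; clear; lia.
have cS w : w \in cls f a ->
    S w * E w <= \sum_(y in hull | solo y) e w y * deg e y + 2 * r.
  rewrite inE => /eqP fw; have := card_light fw => cl.
  apply: (@leq_trans (\sum_(y in hull | solo y)
                        (e w y * deg e y + (y \in light w) * r))).
    rewrite /S big_distrl; apply: leq_sum => y /andP[yK sy] /=.
    rewrite inE yK sy /=; case ewy: (e w y) => //=.
    by have := E_deg w; have := maxd w; case: ltnP => /=; clear; lia.
  rewrite big_split leq_add2l /= -big_distrl leq_mul2r orbC.
  apply/orP; left; apply: leq_trans cl.
  rewrite -sum1_card [leqRHS]big_mkcond [leqLHS]big_mkcond; apply: leq_sum => y _.
  by case: ifP => // _; case: ifP => ->.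
have tot : \sum_(w in cls f a) \sum_(y in hull | solo y) e w y * deg e y
    <= \sum_v deg e v.
  rewrite exchange_big /= [leqRHS](bigID (fun y => (y \in hull) && solo y)) /=.
  apply: leq_trans (leq_addr _ _); apply: leq_sum => y /andP[_ /eqP sy].
  by rewrite -big_distrl /= cnbr_a sy mul1n.
(* Expand [(r - E w) (r - S w) >= 0]. *)
have sumES : \sum_(w in cls f a) r * (E w + S w) <= \sum_(w in cls f a)
    (\sum_(y in hull | solo y) e w y * deg e y + (r * r + 2 * r)).
  apply: leq_sum => w wa; have := cS w wa; have := SE w.
  have := leq_trans (E_deg w) (maxd w).
  move: (\sum_(y in hull | solo y) _) (E w) (S w) => D x y xr yx yxD.
  rewrite -(subnKC xr) in yxD *; move: (r - x) yxD => z.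
  by have := leq_mul (leqnn z) yx; clear; nia.
move: sumES; rewrite -big_distrr [leqRHS]big_split /= sum_nat_const.
by move: tot; have := leq_mul (leqnn r) cE; rewrite !mulnA [r * 2]mulnC; clear; lia.
Qed.

End MinimalNearEquitable.


(** * Colorings with a floating vertex *)

Section Floating.

Variables (T : finType) (e : rel T) (r s : nat).
Hypotheses (irre : irreflexive e) (syme : symmetric e).
Implicit Types (f : {ffun T -> 'I_r}) (a b c : 'I_r).

(* The floating vertex [z] is parked in the deficient class, which really is
   [cls f (f z) :\ z]; conflicts between [z] and that class are ignored. *)
Definition floating f z :=
  [forall c, #|cls f c| == s] &&
  [forall x, forall y, [&& x != z, y != z & e x y] ==> (f x != f y)].

Definition floating_weight f z := \sum_(v in cls f (f z) :\ z) deg e v.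

Lemma floatingP f z :
  reflect ((forall c, #|cls f c| = s) /\
           (forall x y, x != z -> y != z -> e x y -> f x != f y))
          (floating f z).
Proof.
apply: (iffP andP) => [] [sz pf]; split.
- by move=> c; apply/eqP; have/forallP := sz.
- move=> x y xz yz exy; have/forallP/(_ x)/forallP/(_ y)/implyP := pf.
  by apply; rewrite xz yz.
- by apply/forallP=> c; apply/eqP.
- apply/forallP=> x; apply/forallP=> y; apply/implyP=> /and3P[].
  exact: pf.
Qed.

(** [z] has no other neighbor in the class of [y], so it fits there once [y] floats. The deficient
    class without its floating vertex is unchanged, hence so is its weight. *)
Lemma floating_swap f z y :
  floating f z -> f y != f z -> cnbr e f z (f y) = [set y] ->
  let g := recolor (recolor f z (f y)) y (f z) in
  floating g y /\ floating_weight g y = floating_weight f z.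
Proof.
move=> /floatingP[sz pf] yz N1 g.
have zy : z != y by apply: contraNneq yz => ->.
have gy : g y = f z by rewrite ffunE eqxx.
have gz : g z = f y by rewrite !ffunE (negPf zy) eqxx.
have gE v : v != y -> v != z -> g v = f v.
  by move=> vy vz; rewrite !ffunE (negPf vy) (negPf vz).
have zN v : e z v -> v != y -> f v != f y.
  move=> ezv; apply: contraNneq => fv; rewrite -in_set1 -N1.
  by rewrite inE ezv fv eqxx.
split; first (apply/floatingP; split).
- move=> c; have := card_cls_recolor (recolor f z (f y)) y (f z) c.
  have := card_cls_recolor f z (f y) c; have := sz c.
  by rewrite [recolor f z (f y) y]ffunE [y == z]eq_sym (negPf zy) -/g; clear; lia.
- move=> u v uy vy euv.
  have [uz|uz] := eqVneq u z; have [vz|vz] := eqVneq v z.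
  + by move: euv; rewrite uz vz irre.
  + by rewrite uz gz gE // eq_sym zN // -uz.
  + by rewrite vz gz gE // zN // syme -vz.
  + by rewrite !gE //; apply: pf.
rewrite /floating_weight gy; apply: eq_bigl => v; rewrite !inE.
have [->|vy] := eqVneq v y; first by rewrite (negPf yz) andbF.
have [->|vz] := eqVneq v z; first by rewrite gz (negPf yz).
by rewrite gE.
Qed.

(** With [X = f z] the result is an equitable coloring. *)
Lemma near_of_floating f z X :
  floating f z -> cnbr e f z X = set0 -> near e s (recolor f z X) (f z) X.
Proof.
move=> /floatingP[sz pf] /eqP/cnbr0P zX; apply/nearP; split.
  exact: proper_recolor_off.
by move=> c; rewrite card_cls_recolor sz.
Qed.

Lemma weight_recolor_floating f z X :
  X != f z -> weight e (recolor f z X) (f z) = floating_weight f z.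
Proof.
move=> Xz; apply: eq_bigl => v; rewrite !inE ffunE.
by have [->|//] := eqVneq v z; rewrite (negPf Xz).
Qed.

Lemma floating_of_near f a b v :
  near e s f a b -> a != b -> f v = b ->
  floating (recolor f v a) v /\ floating_weight (recolor f v a) v = weight e f a.
Proof.
move=> /nearP[/proper_coloringP pf sz] ab fv; split.
  apply/floatingP; split=> [c|x y xv yv exy].
    by have := card_cls_recolor f v a c; have := sz c; rewrite fv; clear; lia.
  by rewrite !ffunE (negPf xv) (negPf yv) pf.
rewrite /floating_weight; apply: eq_bigl => u; rewrite !inE !ffunE eqxx.
by have [->|//] := eqVneq u v; rewrite fv eq_sym (negPf ab).
Qed.

End Floating.

(** * Incompatibility of the three bounds *)

(** The bounds come from [hull_boundary], [hull_domination] and the floating argument. The last two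
    force [2 c] within [2 d + 1] of [r], so that [c (r - c)] is too close to [r^2 / 4] for the
    first. *)
Lemma coloring_arith d r s c :
  0 < d -> 621 * d <= 100 * r -> 0 < s -> c < r ->
  (c * s + 1) * (r - c) <= d * (r * s) ->
  2 * r * (c * s + 1) <= 2 * d * (r * s) + (r * r + 2 * r) * (s - 1) ->
  r <= 2 * c + 1 + d -> False.
Proof.
move=> d0 dr s0 cr H1 H2 H3.
have c_hi : 2 * c < 2 * d + r + 2.
  have H : 2 * (c * s + 1) <= 2 * d * s + (r + 2) * (s - 1).
    have r0 : 0 < r by apply: leq_trans cr.
    rewrite -(leq_pmul2l r0); apply: leq_trans (leq_trans _ H2) _; clear; lia.
  have : 2 * c * s < (2 * d + r + 2) * s by move: H s0; clear; nia.
  by rewrite ltn_pmul2r.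
have c_mid : c * (r - c) < d * r.
  have : c * (r - c) * s < d * r * s by move: H1 cr; clear; nia.
  by rewrite ltn_pmul2r.
(* [4 c (r - c) = r^2 - (2 c - r)^2] with [`|2 c - r| <= 2 d + 1] *)
have [u ru] : exists u, r = c + u by exists (r - c); rewrite subnKC // ltnW.
have r6 : 6 * d + 1 <= c + u by move: d0 dr; rewrite ru; clear; lia.
move: c_mid; rewrite ru addKn => c_mid.
have [t t_le cu] : exists2 t, t <= 2 * d + 1 & c = u + t \/ u = c + t.
  move: c_hi H3; rewrite ru; case: (leqP u c) => uc c_hi H3.
    by exists (c - u); [lia | left; lia].
  by exists (u - c); [lia | right; lia].
have t2 := leq_mul t_le t_le.
have [k uk] : exists k, c + u = 6 * d + 1 + k.
  by exists (c + u - (6 * d + 1)); rewrite subnKC.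
have sq : 4 * (c * u) + t * t = (c + u) * (c + u).
  by case: cu => ->; clear; lia.
(* With [r = c + u] these give [r (r - 4 d) < (2 d + 1)^2], whereas [r >= 6 d + 1] makes the left
   side at least [(6 d + 1) (2 d + 1)]. *)
move: sq t2 c_mid; rewrite uk; clear; nia.
Qed.


(** * Repairing a coloring with a floating vertex *)

Lemma free_class (T : finType) (e : rel T) r (f : {ffun T -> 'I_r}) z :
  deg e z < r -> exists c, cnbr e f z c = set0.
Proof.
move=> dz; apply/exists_eqP; apply: contraLR dz; rewrite -leqNgt => noX.
rewrite -(sum_cnbr e f z) -[leqLHS]card_ord -sum1_card; apply: leq_sum => c _.
by rewrite card_gt0; apply: contra noX => /eqP E; apply/existsP; exists c; rewrite E.
Qed.

Lemma equitable_of_floating (T : finType) (e : rel T) (d r s : nat)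
    (f : {ffun T -> 'I_r}) x :
  0 < d -> 621 * d <= 100 * r -> irreflexive e -> symmetric e ->
  degenerate e d -> max_deg_le e r -> #|T| = r * s ->
  floating e s f x -> deg e x <= d ->
  exists (g : {ffun T -> 'I_r}) a, near e s g a a.
Proof.
move=> d0 dr irre syme degE maxd cT flx dx.
have dltr : d < r by lia.
have [/existsP[g /existsP[a nga]]|noeq] :=
  boolP [exists g : {ffun T -> 'I_r}, exists a, near e s g a a]; first by exists g, a.
have {}noeq (g : {ffun T -> 'I_r}) a : ~~ near e s g a a.
  by apply: contra noeq => ng; apply/existsP; exists g; apply/existsP; exists a.
exfalso.
have [X0 fX0] := free_class f (leq_ltn_trans dx dltr).
pose P (t : {ffun T -> 'I_r} * 'I_r * 'I_r) := near e s t.1.1 t.1.2 t.2.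
have P0 : P (recolor f x X0, f x, X0) by exact: near_of_floating.
pose W (t : {ffun T -> 'I_r} * 'I_r * 'I_r) := weight e t.1.1 t.1.2.
have [[[g a] b] Pg Wmin] := @arg_minnP _ _ P W P0.
have {Wmin} gmin (f' : {ffun T -> 'I_r}) a' b' :
    near e s f' a' b' -> weight e g a <= weight e f' a'.
  by move=> nf'; apply: (Wmin (f', a', b')).
have {Pg} ng : near e s g a b by [].
have ab : a != b by apply: contraTneq ng => <-; exact: noeq.
(* The vertices that can float at the minimal weight; swaps preserve the weight and so stay within
   [Z]. *)
pose Z := [set z | [exists h : {ffun T -> 'I_r},
  floating e s h z && (floating_weight e h z == weight e g a)]].
have [v gv] : exists v, g v = b.
  have /nearP[_ /(_ b)] := ng; rewrite eqxx eq_sym (negPf ab) addn0 addn1 => cb.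
  have /set0Pn[v] : cls g b != set0 by rewrite -card_gt0 cb.
  by rewrite inE => /eqP; exists v.
have Z0 : Z != set0.
  apply/set0Pn; exists v; rewrite inE; apply/existsP; exists (recolor g v a).
  have [-> ->] := floating_of_near ng ab gv; exact: eqxx.
have /(degenerate_induced _ syme)/(_ Z Z0)[z] := degE.
rewrite {1}inE => /existsP[h /andP[flh /eqP wh]] dz.
set a' := h z in wh.
pose n c := #|cnbr e h z c|.
have na : 0 < n a'.
  rewrite /n card_gt0; apply: contra (noeq (recolor h z a') a') => /eqP.
  exact: near_of_floating.
(* The single neighbor of [z] in such a class can float after a swap, so it is one of the at most
   [d] neighbors of [z] in [Z]. *)
have n1 : \sum_(c | c != a') (n c == 1) * n c <= d.
  apply: leq_trans dz; rewrite -sum1_card (partition_big h predT) //=.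
  rewrite [leqRHS](bigD1 a') //=; apply: leq_trans (leq_addl _ _).
  apply: leq_sum => c ca; case: eqP; rewrite ?mul0n // mul1n => n1.
  rewrite n1 sum1dep_card card_gt0; apply/set0Pn.
  have /eqP/cards1P[y Ny] := n1; exists y.
  have : y \in cnbr e h z c by rewrite Ny inE.
  rewrite !inE => /andP[ezy /eqP hy]; rewrite ezy hy eqxx !andbT.
  have [||fl' w'] := floating_swap irre syme flh (y := y); rewrite ?hy //.
  apply/existsP; exists (recolor (recolor h z (h y)) y (h z)).
  by rewrite fl' w' wh eqxx.
have tot : n a' + \sum_(c | c != a') n c <= r.
  by apply: leq_trans (maxd z); rewrite -(sum_cnbr e h z) [leqRHS](bigD1 a').
pose F := [set c | (c != a') && (n c == 0)].
(* Off [a'] the [n c] sum to at most [r - 1]; raising each to 2 costs at most [d] for the ones and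
   [2 * #|F|] for the zeros. *)
have cF : r <= 2 * #|F| + 1 + d.
  have : \sum_(c | c != a') 2 <=
      \sum_(c | c != a') (n c + ((n c == 1) * n c + 2 * (n c == 0))).
    by apply: leq_sum => c _; case: (n c) => [|[|]].
  rewrite sum_nat_const cardC1 card_ord 2!big_split /=.
  have -> : \sum_(c | c != a') 2 * (n c == 0) = 2 * #|F|.
    rewrite -sum1dep_card big_distrr big_mkcond [RHS]big_mkcond.
    by apply: eq_bigr => c _; case: (c != a'); case: (n c == 0).
  have aux y0 y1 y2 : 0 < y0 -> y0 + y1 <= r -> y2 <= d ->
      r.-1 * 2 <= y1 + (y2 + 2 * #|F|) -> r <= 2 * #|F| + 1 + d by clear; lia.
  exact: aux na tot n1.
have [X] : exists X, X \in F.
  by apply/set0Pn; rewrite -card_gt0; move: cF d0 dr; clear; lia.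
rewrite inE => /andP[Xa /eqP/eqP]; rewrite cards_eq0 => /eqP hX.
have nk := near_of_floating irre syme flh hX.
have wk := weight_recolor_floating e Xa.
pose k := recolor h z X; rewrite -/k -/a' wh in nk wk.
have kmin (f' : {ffun T -> 'I_r}) a1 b1 :
    near e s f' a1 b1 -> weight e k a' <= weight e f' a1.
  by rewrite wk; apply: gmin.
(* Dropped into [X], the vertex [z] itself can move on to every class of [F]. *)
have FC : #|F| <= #|reached e k X|.
  apply: subset_leq_card; apply/subsetP=> c; rewrite !inE => /andP[ca].
  rewrite cards_eq0 => /cnbr0P nc; apply: connect1; apply/existsP; exists z.
  rewrite ffunE eqxx eqxx; apply/cnbr0P=> u ezu; rewrite ffunE.
  by have [uz|_] := eqVneq u z; [rewrite uz irre in ezu | exact: nc].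
have Cr : #|reached e k X| < r.
  have := max_card (mem (a' |: reached e k X)); rewrite cardsU1 card_ord.
  by rewrite (reached_bottom irre syme noeq nk).
have sumd : \sum_v deg e v <= 2 * d * (r * s).
  by rewrite -cT; apply: degenerate_sum_deg.
have hK := card_hull irre syme noeq nk.
have hb := leq_trans (hull_boundary syme k X) sumd.
have hd := leq_trans (hull_domination irre syme maxd noeq nk kmin) (leq_add sumd (leqnn _)).
have ca : #|cls k a'| = s - 1 /\ 0 < s.
  have /nearP[_ /(_ a')] := nk; rewrite eqxx eq_sym (negPf Xa); clear; lia.
case: ca => ca s0; rewrite hK in hb hd; rewrite ca in hd.
apply: (coloring_arith d0 dr s0 Cr) => //.
- by move: hb; rewrite -!mulnA leq_pmul2l.
- by move: cF FC; clear; lia.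
Qed.


(** * Vertex number divisible by [r]: induction on edges *)

Lemma balanced_map (T : finType) r s : #|T| = r * s ->
  exists f : {ffun T -> 'I_r}, forall c, #|cls f c| = s.
Proof.
move=> cT; have cRS : #|T| = #|{: 'I_r * 'I_s}| by rewrite card_prod !card_ord.
pose g x : 'I_r * 'I_s := enum_val (cast_ord cRS (enum_rank x)).
pose g' p : T := enum_val (cast_ord (esym cRS) (enum_rank p)).
have g'K : cancel g' g by move=> p; rewrite /g /g' enum_valK cast_ordKV enum_rankK.
have gK : cancel g g' by move=> x; rewrite /g /g' enum_valK cast_ordK enum_rankK.
exists [ffun x => (g x).1] => c.
have -> : cls [ffun x => (g x).1] c = [set g' (c, j) | j : 'I_s].
  apply/setP=> x; rewrite inE ffunE; apply/eqP/imsetP => [<-|[j _ ->]].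
    by exists (g x).2; rewrite // -surjective_pairing gK.
  by rewrite g'K.
by rewrite card_imset ?card_ord // => i j /(can_inj g'K) [].
Qed.

Lemma equitable_divisible (T : finType) (e : rel T) (d r s : nat) :
  0 < d -> 621 * d <= 100 * r -> irreflexive e -> symmetric e ->
  degenerate e d -> max_deg_le e r -> #|T| = r * s ->
  exists (g : {ffun T -> 'I_r}) a, near e s g a a.
Proof.
move=> d0 dr + + + + cT; have r0 : 0 < r by lia.
have [m] := ubnP #|[set p | e p.1 p.2]|.
elim: m e => // m IH e; rewrite ltnS => le_m irre syme degE maxd.
(* The non-isolated vertices: a low-degree vertex chosen among them has an edge to delete. Its
   degree within [S] is its full degree. *)
pose S := [set v | [exists u, e v u]].
have [S0|Sn0] := eqVneq S set0.
  have [f szf] := balanced_map cT; exists f, (Ordinal r0); apply/nearP; split.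
    apply/proper_coloringP=> x y exy; have : x \in S by rewrite inE; apply/existsP; exists y.
    by rewrite S0 inE.
  by move=> c; rewrite szf.
have /(degenerate_induced _ syme)/(_ S Sn0)[x] := degE.
rewrite inE => /existsP[y exy] dx'.
have {dx'} dx : deg e x <= d.
  apply: leq_trans dx'; apply: subset_leq_card; apply/subsetP=> u.
  by rewrite !inE => exu; rewrite exu andbT; apply/existsP; exists x; rewrite syme.
pose e' : rel T := fun u v => [&& u != x, v != x & e u v].
have sub_e' u v : e' u v -> e u v by case/and3P.
have syme' : symmetric e' by move=> u v; rewrite /e' syme andbCA.
have irre' : irreflexive e' by move=> u; rewrite /e' irre !andbF.
have [|||g [a /nearP[/proper_coloringP pg sz]]] := IH e' _ irre' syme'.
- apply: leq_trans le_m; apply: proper_card; apply/properP; split.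
    by apply/subsetP=> -[u v]; rewrite !inE; apply: sub_e'.
  by exists (x, y); rewrite !inE //= /e' eqxx.
- exact: (degenerate_inj syme syme' (h := id)) degE.
- move=> v; apply: leq_trans (maxd v); apply: subset_leq_card.
  by apply/subsetP=> u; rewrite !inE; apply: sub_e'.
apply: (equitable_of_floating (f := g) (x := x) d0 dr) => //.
(* Only edges at [x] were deleted, so in [e] the vertex [x] floats. *)
apply/floatingP; split=> [c|u v ux vx euv]; first by have := sz c; clear; lia.
by apply: pg; rewrite /e' ux vx.
Qed.

(** * Padding with a clique *)

(** The added vertices form a clique so that each color class contains at most one of them, and
    removing them keeps the coloring equitable. *)
Definition pad_clique (T : finType) (e : rel T) k : rel (T + 'I_k)%type :=
  fun x y => match x, y with
  | inl u, inl v => e u v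
  | inr i, inr j => i != j
  | _, _ => false
  end.

Lemma equitable_pad (T : finType) (e : rel T) (d r s k : nat) :
  0 < d -> 621 * d <= 100 * r -> simple_graph e ->
  degenerate e d -> max_deg_le e r -> k <= d.+1 -> #|T| + k = r * s ->
  exists f : T -> 'I_r, equitable_coloring e f.
Proof.
move=> d0 dr [irre syme] degE maxd kd cT.
pose e2 := @pad_clique T e k.
have sym2 : symmetric e2 by case=> [u|i] [v|j] //=; rewrite eq_sym.
have irr2 : irreflexive e2 by case=> [u|i] //=; rewrite eqxx.
have deg_inr (A : {set T + 'I_k}) (i : 'I_k) :
    #|[set y in A | e2 (inr i) y]| <= d.
  rewrite -ltnS; apply: leq_trans kd; rewrite -[leqRHS]card_ord.
  rewrite (cardD1 i) inE add1n ltnS -(card_imset _ (@inr_inj T 'I_k)) subset_leq_card //.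
  apply/subsetP=> -[u|j]; rewrite !inE ?andbF // => /andP[_ ij].
  by rewrite imset_f // !inE eq_sym andbT; exact: ij.
have [|||g [c0 /nearP[/proper_coloringP pg sz]]] :=
    equitable_divisible (s := s) d0 dr irr2 sym2.
- apply/(degenerate_induced _ sym2) => A A0.
  have [S0|Sn0] := eqVneq [set x | inl x \in A] set0.
    case/set0Pn: A0 => -[u|i] yA; last by exists (inr i).
    by have := in_set0 u; rewrite -S0 inE yA.
  have /(degenerate_induced _ syme)/(_ _ Sn0)[v] := degE; rewrite inE => vA dv.
  exists (inl v) => //; apply: leq_trans dv; rewrite -(card_imset _ (@inl_inj T 'I_k)).
  apply: subset_leq_card; apply/subsetP=> -[u|j]; rewrite !inE ?andbF //.
  by case/andP=> uA evu; rewrite imset_f // !inE uA.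
- case=> [v|i].
    apply: leq_trans (maxd v); rewrite /deg -(card_imset _ (@inl_inj T 'I_k)).
    apply: subset_leq_card; apply/subsetP=> -[u|j]; rewrite !inE // => evu.
    by rewrite imset_f // inE.
  apply: (@leq_trans d); last by lia.
  have := deg_inr setT i; apply: leq_trans; apply: subset_leq_card.
  by apply/subsetP=> y; rewrite !inE.
- by rewrite card_sum card_ord.
have {}sz c : #|cls g c| = s by have := sz c; clear; lia.
exists (fun x => g (inl x)); split=> [x y exy|i j]; first exact: pg.
apply: (@leq_trans s).
  rewrite -(sz i) -(card_imset _ (@inl_inj T 'I_k)) subset_leq_card //.
  by apply/subsetP=> _ /imsetP[x + ->]; rewrite !inE.
rewrite -(sz j); pose D := [set l | g (inr l) == j].
have D1 : #|D| <= 1.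
  apply/card_le1_eqP=> l l'; rewrite !inE => /eqP gl /eqP gl'; apply/eqP.
  apply: contraTT isT => ll'; have := pg (inr l') (inr l) ll'.
  by rewrite gl gl' eqxx.
have sub : cls g j \subset (inl @: [set x | g (inl x) == j]) :|: (inr @: D).
  apply/subsetP=> -[x|l]; rewrite !inE => gj; apply/orP; [left | right];
  by rewrite imset_f // inE.
apply: leq_trans (subset_leq_card sub) _; rewrite -addn1.
apply: leq_trans (leq_card_setU _ _) _; rewrite !card_imset ?leq_add2l //.
  exact: inr_inj.
exact: inl_inj.
Qed.


(** * Inserting a vertex, and the general case *)

Lemma equitable_sizes (T : finType) r (f : {ffun T -> 'I_r}) :
  0 < r -> (forall i j, #|cls f i| <= #|cls f j|.+1) ->
  exists t, [/\ forall c, t <= #|cls f c| <= t.+1,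
    #|T| + #|[set c | #|cls f c| == t]| = r * t.+1
    & 0 < #|[set c | #|cls f c| == t]|].
Proof.
move=> r0 eqf; pose c0 := [arg min_(c < Ordinal r0) #|cls f c|].
have c0min c : #|cls f c0| <= #|cls f c| by rewrite /c0; case: arg_minnP => // i _; apply.
exists #|cls f c0|; set t := #|cls f c0|.
have bd c : t <= #|cls f c| <= t.+1 by rewrite c0min eqf.
split=> //; last by rewrite card_gt0; apply/set0Pn; exists c0; rewrite inE.
have -> : #|T| = \sum_c #|cls f c|.
  rewrite -sum1_card (partition_big f predT) //=; apply: eq_bigr => c _.
  by rewrite sum1dep_card.
have -> : #|[set c | #|cls f c| == t]| = \sum_c (#|cls f c| == t).
  by rewrite -sum1dep_card big_mkcond; apply: eq_bigr => c _; case: eqP.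
have -> : r * t.+1 = \sum_(c < r) t.+1 by rewrite sum_nat_const card_ord.
rewrite -big_split; apply: eq_bigr => c _ /=.
by have := bd c; case: eqP; clear; lia.
Qed.

(** There are more classes of the smaller size [t] than neighbors of [x], so [x] can join one that
    contains no neighbor. *)
Lemma equitable_insert (T : finType) (e : rel T) (r t : nat) x
    (f : {ffun {y : T | y != x} -> 'I_r}) :
  simple_graph e -> (forall u v, e (val u) (val v) -> f u != f v) ->
  (forall c, t <= #|cls f c| <= t.+1) ->
  deg e x < #|[set c | #|cls f c| == t]| ->
  exists g : T -> 'I_r, equitable_coloring e g.
Proof.
move=> [irre syme] pf bd dx.
have /card_gt0P[c1 _] := leq_ltn_trans (leq0n _) dx.
pose h c0 (y : T) := if insub y is Some u then f u else c0.
have hval c0 u : h c0 (val u) = f u by rewrite /h valK.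
have hx c0 : h c0 x = c0 by rewrite /h insubF ?eqxx.
have hE c0 y : y != x -> exists2 u, val u = y & h c0 y = f u.
  by move=> yx; exists (Sub y yx); rewrite ?SubK // -(hval c0) SubK.
have [c0 ct xc0] : exists2 c0, #|cls f c0| = t & forall y, e x y -> h c0 y != c0.
  (* The default color [c1] is immaterial here, since no neighbor of [x] is [x] itself. *)
  pose N := [set h c1 y | y in [set y | e x y]].
  have : ~~ ([set c | #|cls f c| == t] \subset N).
    apply: contraL dx => /subset_leq_card le; rewrite -leqNgt.
    exact: leq_trans le (leq_imset_card _ _).
  case/subsetPn=> c; rewrite inE => /eqP ct cN; exists c => // y exy.
  apply: contraNneq cN => hy; apply/imsetP; exists y; rewrite ?inE // -hy.
  have yx : y != x by apply: contraTneq exy => ->; rewrite irre.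
  by have [u <- _] := hE c y yx; rewrite !hval.
exists (h c0); split=> [y z eyz|i j].
  have [yx|yx] := eqVneq y x; first by rewrite yx hx eq_sym xc0 // -yx.
  have [zx|zx] := eqVneq z x; first by rewrite zx hx xc0 // -zx syme.
  have [u uy _] := hE c0 y yx; have [v vz _] := hE c0 z zx.
  by rewrite -uy -vz !hval pf // uy vz.
have szh c : #|[set y | h c0 y == c]| = #|cls f c| + (c == c0).
  rewrite (cardsD1 x) inE hx (eq_sym c) addnC; congr (_ + _).
  rewrite -(card_imset _ val_inj); apply: eq_card => y; rewrite !inE.
  apply/andP/imsetP => [[yx hy]|[u + ->]].
    by have [u uy hu] := hE c0 y yx; exists u; rewrite // inE -hu.
  by rewrite inE hval; split=> //; exact: (valP u).
rewrite !szh; have := bd i; have := bd j.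
by case: eqP => [->|_]; case: eqP => [->|_]; rewrite ?ct; clear; lia.
Qed.

(* Delta >= 6.21 d is written as 100 * Delta >= 621 * d. *)
Theorem theorem3 (d Delta : nat) :
  0 < d -> 621 * d <= 100 * Delta ->
  forall (T : finType) (e : rel T),
    simple_graph e -> degenerate e d -> max_deg_le e Delta ->
    exists f : T -> 'I_Delta, equitable_coloring e f.
Proof.
move=> d0 dr T e; have r0 : 0 < Delta by lia.
have [n] := ubnP #|T|; elim: n T e => // n IH T e; rewrite ltnS => leTn sg degE maxd.
have [/existsP[k /dvdnP[s Ek]]|no_pad] :=
    boolP [exists k : 'I_d.+2, Delta %| #|T| + k].
  have kd : k <= d.+1 by rewrite -ltnS.
  by apply: (equitable_pad d0 dr sg degE maxd kd); rewrite Ek mulnC.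
have [irre syme] := sg.
have T0 : [set: T] != set0.
  rewrite -card_gt0 cardsT lt0n; apply: contra no_pad => /eqP->.
  by apply/existsP; exists ord0; rewrite dvdn0.
have /(degenerate_induced _ syme)/(_ _ T0)[x _ dx'] := degE.
have dx : deg e x <= d.
  apply: leq_trans dx'; apply: subset_leq_card; apply/subsetP=> u.
  by rewrite !inE.
pose T' : finType := {y : T | y != x}.
pose e' : rel T' := fun u v => e (val u) (val v).
have cT' : #|T'|.+1 = #|T|.
  by rewrite card_sig cardC1 prednK // -cardsT card_gt0.
have [||||f [pf eqf]] := IH T' e'.
- by rewrite -ltnS cT'.
- by split=> [u|u v]; [exact: irre | exact: syme].
- apply: (degenerate_inj syme (e' := e') (h := val)) => //.
    by move=> u v; exact: syme.
  exact: val_inj.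
- move=> u; apply: leq_trans (maxd (val u)); rewrite /deg -(card_imset _ val_inj).
  by apply: subset_leq_card; apply/subsetP=> _ /imsetP[v + ->]; rewrite !inE.
have fE : finfun f =1 f by exact: ffunE.
have [|t [bd cS S0]] := equitable_sizes (f := finfun f) r0.
  move=> i j; have := eqf i j; congr (_ <= _.+1).
    by apply: eq_card => y; rewrite !inE fE.
  by apply: eq_card => y; rewrite !inE fE.
apply: (equitable_insert (f := finfun f) sg _ bd).
  by move=> u v euv; rewrite !fE; apply: pf.
(* If only [m <= d] classes had size [t], then [#|T| + (m - 1) = Delta * t.+1] would make [m - 1] an
   admissible padding. *)
apply: leq_ltn_trans dx _; rewrite ltnNge; apply: contra no_pad => Sd.
set m := #|[set _ | _]| in cS S0 Sd.
have m2 : m.-1 < d.+2 by move: Sd; clear; lia.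
apply/existsP; exists (Ordinal m2); apply/dvdnP; exists t.+1.
by rewrite mulnC -cS -cT' /=; move: S0; clear; lia.
Qed.
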